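(* Let $\tau>0$, let $U:[0,\tau]\to\mathbb{R}$ be a non-negative continuous function and let $c_0,c_1>0$ be fixed. Suppose that $$U(t)\le c_0+c_1\int_t^\tau\left(U(s)+\int_s^\tau U(\xi)\,d\xi\right)ds,\qquad 0\le t\le\tau.$$ Then $$U(t)\le c_0\,e^{(1+c_1)(\tau-t)},\qquad 0\le t\le\tau.$$
   Context: No special notation is needed. *)

(* Defs.v *)
From Stdlib Require Export Reals.
From Coquelicot Require Export Coquelicot.

(* Main.v *)
(** Write [G t] for the integral of [U] over [t, tau] and [W t] for the right-hand
    side of the hypothesis, so that [U <= W].  The sum [Z = W + G] dominates [U], and
    [Z' = - c1 (U + G) - U >= - (1 + c1) Z], so [Z t * exp ((1 + c1) t)] is
    nondecreasing, with value [c0 * exp ((1 + c1) tau)] at [tau]. *)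
Require Import Defs.
From Stdlib Require Import Reals Lra.
From Coquelicot Require Import Coquelicot.
Open Scope R_scope.

(** Projection of the line onto [[a, b]]. Precomposing with it extends a function continuous on
    [[a, b]] to one continuous on all of [R], so integrals can be differentiated at the endpoints
    too. *)
Definition clamp (a b x : R) : R := Rmax a (Rmin x b).

Lemma clamp_bounds (a b x : R) : a <= b -> a <= clamp a b x <= b.
Proof.
  intros hab; unfold clamp, Rmax, Rmin.
  repeat destruct Rle_dec; lra.
Qed.

Lemma clamp_id (a b x : R) : a <= x <= b -> clamp a b x = x.
Proof.
  intros hx; unfold clamp, Rmax, Rmin.
  repeat destruct Rle_dec; lra.
Qed.

Lemma clamp_lipschitz (a b x y : R) : Rabs (clamp a b y - clamp a b x) <= Rabs (y - x).
Proof.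
  unfold clamp, Rmax, Rmin.
  repeat destruct Rle_dec; unfold Rabs; repeat destruct Rcase_abs; lra.
Qed.

(** The clamp is 1-Lipschitz with values in [[a, b]], so the radius [eps] that works for [f] at the
    clamped point works unchanged at [x]. *)
Lemma continuous_comp_clamp (f : R -> R) (a b x : R) :
  a <= b -> continuous_on (fun t : R => a <= t <= b) f ->
  continuous (fun t => f (clamp a b t)) x.
Proof.
  intros hab hf P HP.
  destruct (hf _ (clamp_bounds a b x hab) P HP) as [eps He].
  exists eps; intros y Hy.
  apply He; [|apply clamp_bounds, hab].
  apply Rle_lt_trans with (2 := Hy), clamp_lipschitz.
Qed.

Lemma is_derive_RInt_lower (f : R -> R) (b x : R) :
  (forall y, continuous f y) -> is_derive (fun t => RInt f t b) x (- f x).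
Proof.
  intros hf.
  apply (is_derive_RInt' f (fun t => RInt f t b) x b); [|apply hf].
  apply filter_forall; intros t.
  apply (RInt_correct f), (ex_RInt_continuous f); intros; apply hf.
Qed.

(** The estimate for a globally continuous, non-negative [V]: the integrals are then differentiable
    at every real, while the integral inequality is still assumed only on [[0, tau]]. *)
Lemma gronwall_iterated (tau c0 c1 : R) (V : R -> R) :
  (forall x, continuous V x) -> (forall x, 0 <= V x) -> 0 < c1 ->
  (forall t, 0 <= t <= tau ->
    V t <= c0 + c1 * RInt (fun s => V s + RInt V s tau) t tau) ->
  forall t, 0 <= t <= tau -> V t <= c0 * exp ((1 + c1) * (tau - t)).
Proof.
  intros hc hpos hc1 hV t ht.
  set (G := fun s => RInt V s tau).
  set (F := fun s => V s + G s).
  set (Z := fun s => c0 + c1 * RInt F s tau + G s).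
  assert (hG : forall x, is_derive G x (- V x)).
  { intros x; apply is_derive_RInt_lower, hc. }
  assert (hGpos : forall x, x <= tau -> 0 <= G x).
  { intros x hx; apply RInt_ge_0; auto.
    apply (ex_RInt_continuous V); auto. }
  assert (hFc : forall x, continuous F x).
  { intros x; apply (continuous_plus V G); [apply hc|].
    apply (ex_derive_continuous G); eexists; apply hG. }
  assert (hZ : forall x, is_derive Z x (- c1 * F x - V x)).
  { intros x; unfold Z.
    evar_last.
    - apply (is_derive_plus (fun s => c0 + c1 * RInt F s tau) G); [|apply hG].
      apply (is_derive_plus (fun _ => c0) (fun s => c1 * RInt F s tau)).
      + apply is_derive_const.
      + apply is_derive_scal, is_derive_RInt_lower, hFc.
    - unfold plus, zero; simpl; ring. }
  assert (hmono : Z t * exp ((1 + c1) * t) <= Z tau * exp ((1 + c1) * tau)).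
  { pose (H := fun s => Z s * exp ((1 + c1) * s)).
    pose (dH := fun s => ((- c1 * F s - V s) + (1 + c1) * Z s) * exp ((1 + c1) * s)).
    destruct (MVT_gen H t tau dH) as [c [hcb hceq]].
    - intros x _; unfold H, dH; evar_last.
      + apply (is_derive_mult Z (fun s => exp ((1 + c1) * s))); [apply hZ| |intros; apply Rmult_comm].
        auto_derive; [exact I|reflexivity].
      + unfold plus, mult; simpl; ring.
    - intros x _; apply continuity_pt_filterlim.
      apply (ex_derive_continuous H).
      apply (ex_derive_mult Z (fun s => exp ((1 + c1) * s)));
        [eexists; apply hZ|auto_derive; exact I].
    - rewrite Rmin_left, Rmax_right in hcb by lra.
      enough (0 <= dH c * (tau - t)) by (unfold H in *; lra).
      apply Rmult_le_pos; [|lra].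
      apply Rmult_le_pos; [|apply Rlt_le, exp_pos].
      (* With [W = Z - G], the bracket in [dH c] equals [(1 + c1) * (W c - V c) + G c], and both
         terms are non-negative. *)
      specialize (hV c ltac:(lra)); specialize (hGpos c ltac:(lra)).
      fold G F in hV; change (RInt (fun s => V s + RInt V s tau)) with (RInt F) in hV.
      unfold Z, F at 1; nra. }
  assert (hend : Z tau = c0).
  { unfold Z, G; rewrite !RInt_point; unfold zero; simpl; ring. }
  assert (hVZ : V t <= Z t).
  { specialize (hV t ht); specialize (hGpos t ltac:(lra)).
    change (RInt (fun s => V s + RInt V s tau)) with (RInt F) in hV.
    unfold Z; lra. }
  apply Rle_trans with (1 := hVZ).
  (* Multiplying by the integrating factor at [t] turns the goal into [hmono], once [c0] is read as
     [Z tau]. *)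
  apply Rmult_le_reg_r with (1 := exp_pos ((1 + c1) * t)).
  rewrite Rmult_assoc, <- exp_plus.
  replace ((1 + c1) * (tau - t) + (1 + c1) * t) with ((1 + c1) * tau) by ring.
  rewrite <- hend at 1; exact hmono.
Qed.

Theorem lemma3p1 (tau : R) (U : R -> R) (c0 c1 : R)
  (htau : 0 < tau)
  (hUcont : continuous_on (fun t : R => 0 <= t <= tau) U)
  (hUnonneg : forall t : R, 0 <= t <= tau -> 0 <= U t)
  (hc0 : 0 < c0) (hc1 : 0 < c1)
  (hU : forall t : R, 0 <= t <= tau ->
    U t <= c0 + c1 * RInt (fun s : R => U s + RInt (fun xi : R => U xi) s tau) t tau) :
  forall t : R, 0 <= t <= tau ->
    U t <= c0 * exp ((1 + c1) * (tau - t)).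
Proof.
  intros t ht.
  pose (V := fun x => U (clamp 0 tau x)).
  assert (hVU : forall x, 0 <= x <= tau -> V x = U x).
  { intros x hx; unfold V; now rewrite clamp_id. }
  (* Both the inner and the outer integrals range inside [[0, tau]], where [V] and [U] coincide, so
     the hypothesis on [U] carries over to [V]. *)
  assert (hInt : forall s, 0 <= s <= tau -> RInt V s tau = RInt U s tau).
  { intros s hs; apply RInt_ext; intros x.
    rewrite Rmin_left, Rmax_right by lra; intros; apply hVU; lra. }
  rewrite <- hVU by exact ht.
  apply gronwall_iterated; trivial.
  - intros x; apply continuous_comp_clamp; [lra|exact hUcont].
  - intros x; apply hUnonneg, clamp_bounds; lra.
  - intros s hs.
    rewrite hVU by exact hs.
    rewrite (RInt_ext _ (fun r => U r + RInt U r tau)); [apply hU, hs|].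
    intros x; rewrite Rmin_left, Rmax_right by lra; intros.
    now rewrite hVU, hInt by lra.
Qed.
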